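(* Let $\ell^{OI}$ be a line in a Desargues affine plane, with its skew field structure $(\ell^{OI},+,\cdot)$ given by addition and multiplication of points. Let $B,C,D\in\ell^{OI}$ be three fixed, pairwise different points, each different from $O$. For $X\in\ell^{OI}$ put $\mu(X)=c_r(X,B;C,D)=[(X-D)^{-1}(B-D)][(B-C)^{-1}(X-C)]$ and let $\mathcal{R}^{A}_4=\{\mu(X)\mid X\in\ell^{OI}\}$. Then the elements $\mu(\cdot)$ of $\mathcal{R}^{A}_4$, with addition of points, satisfy: (1) associativity: $[\mu(X)+\mu(Y)]+\mu(Z)=\mu(X)+[\mu(Y)+\mu(Z)]$ for all $X,Y,Z\in\ell^{OI}$; (2) commutativity: $\mu(X)+\mu(Y)=\mu(Y)+\mu(X)$ for all $X,Y\in\ell^{OI}$; (3) existence of a neutral (zero) element: there is $Z\in\ell^{OI}$ such that $\mu(X)+\mu(Z)=\mu(X)$ for all $X\in\ell^{OI}$.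
   Context: A Desargues affine plane is an affine plane (two distinct points lie on exactly one line; through a point $P$ not on a line $\ell$ passes exactly one line disjoint from $\ell$; there are three non-collinear points) satisfying Desargues' axiom: if $\ell^{AA'},\ell^{BB'},\ell^{CC'},\ell^{AC},\ell^{A'C'}$ are pairwise distinct lines such that $\ell^{AA'},\ell^{BB'},\ell^{CC'}$ are all parallel or all meet in one point $P$, and if $\ell^{AB}\parallel\ell^{A'B'}$, $\ell^{BC}\parallel\ell^{B'C'}$, $A\ne C$, $A'\ne C'$, $\ell^{AB}\ne\ell^{A'B'}$, $\ell^{BC}\ne\ell^{B'C'}$, then $\ell^{AC}\parallel\ell^{A'C'}$. Here $\ell^{PQ}$ is the line through $P,Q$, and $\ell^{R}_{PQ}$ is the line through $R$ parallel to $\ell^{PQ}$. Fix a line $\ell^{OI}$ through two distinct points $O,I$. For $A,B\in\ell^{OI}$ and an auxiliary point $B_1\notin\ell^{OI}$: addition: $P_1=\ell^{B_1}_{OI}\cap\ell^{A}_{OB_1}$ and $A+B=\ell^{P_1}_{BB_1}\cap\ell^{OI}$; multiplication: $P_1=\ell^{A}_{IB_1}\cap\ell^{OB_1}$ and $A\cdot B=\ell^{P_1}_{BB_1}\cap\ell^{OI}$. It is known that $(\ell^{OI},+,\cdot)$ is a skew field (division ring) with zero $O$ and unit $I$. Cross-ratio: for four points $A,B,C,D\in\ell^{OI}$, no three of them equal, $c_r(A,B;C,D)=[(A-D)^{-1}(B-D)][(B-C)^{-1}(A-C)]$, computed in this skew field. The paper writes the cross-ratio for all $X\in\ell^{OI}$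 and gives no separate convention for a value of $X$ at which an inverse of $O$ would occur. *)

(* Defs.v *)
From Stdlib Require Import List ClassicalEpsilon.
Import ListNotations.

Set Implicit Arguments.
Unset Strict Implicit.

Record affine_plane : Type := AffinePlane {
  point : Type;
  line : Type;
  on : point -> line -> Prop;
  unique_join : forall P Q : point, P <> Q ->
    exists! l : line, on P l /\ on Q l;
  unique_parallel : forall (P : point) (l : line), ~ on P l ->
    exists! m : line, on P m /\ ~ (exists Q : point, on Q l /\ on Q m);
  (* The distinctness clause matters: without it, a single point and no line
     would satisfy all three axioms. *)
  noncollinear_triple : exists P Q R : point,
    P <> Q /\ Q <> R /\ P <> R /\
    ~ (exists l : line, on P l /\ on Q l /\ on R l)
}.

Definition parallel (pl : affine_plane) (l m : line pl) : Prop :=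
  l = m \/ ~ (exists P : point pl, on P l /\ on P m).

(* The lines are named by the pairs of points they carry.  Coincidences such as
   A = A', A = B or B = C need no separate exclusion: they contradict the
   hypotheses (for instance A = A' would force lAB = lA'B'). *)
Definition desargues_axiom (pl : affine_plane) : Prop :=
  forall (A B C A' B' C' : point pl)
         (lAA' lBB' lCC' lAB lA'B' lBC lB'C' lAC lA'C' : line pl),
    on A lAA' /\ on A' lAA' ->
    on B lBB' /\ on B' lBB' ->
    on C lCC' /\ on C' lCC' ->
    on A lAB /\ on B lAB ->
    on A' lA'B' /\ on B' lA'B' ->
    on B lBC /\ on C lBC ->
    on B' lB'C' /\ on C' lB'C' ->
    on A lAC /\ on C lAC ->
    on A' lA'C' /\ on C' lA'C' ->
    NoDup [lAA'; lBB'; lCC'; lAC; lA'C'] ->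
    (parallel lAA' lBB' /\ parallel lBB' lCC' /\ parallel lAA' lCC') \/
    (exists P : point pl, on P lAA' /\ on P lBB' /\ on P lCC') ->
    parallel lAB lA'B' ->
    parallel lBC lB'C' ->
    A <> C -> A' <> C' ->
    lAB <> lA'B' -> lBC <> lB'C' ->
    parallel lAC lA'C'.

Lemma point_inhabited (pl : affine_plane) : inhabited (point pl).
Proof.
destruct (noncollinear_triple pl) as [P _]; exact (inhabits P).
Qed.

Lemma line_inhabited (pl : affine_plane) : inhabited (line pl).
Proof.
destruct (noncollinear_triple pl) as [P [Q [_ [PQ _]]]].
destruct (unique_join PQ) as [l _]; exact (inhabits l).
Qed.

(* Meaningful for P <> Q. *)
Definition join (pl : affine_plane) (P Q : point pl) : line pl :=
  epsilon (line_inhabited pl) (fun l => on P l /\ on Q l).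

Definition parallel_at (pl : affine_plane) (R : point pl) (l : line pl)
    : line pl :=
  epsilon (line_inhabited pl) (fun m => on R m /\ parallel l m).

(* Meaningful when l and m are not parallel. *)
Definition meet (pl : affine_plane) (l m : line pl) : point pl :=
  epsilon (point_inhabited pl) (fun P => on P l /\ on P m).

Definition sum_via (pl : affine_plane) (O I B1 A B : point pl) : point pl :=
  let P1 := meet (parallel_at B1 (join O I)) (parallel_at A (join O B1)) in
  meet (parallel_at P1 (join B B1)) (join O I).

Definition product_via (pl : affine_plane) (O I B1 A B : point pl)
    : point pl :=
  let P1 := meet (parallel_at A (join I B1)) (join O B1) in
  meet (parallel_at P1 (join B B1)) (join O I).

(* In a Desargues plane the constructions do not depend on the auxiliary point
   B1 off the line OI; no particular B1 is singled out here. *)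
Definition add (pl : affine_plane) (O I A B : point pl) : point pl :=
  epsilon (inhabits O) (fun S =>
    exists B1 : point pl, ~ on B1 (join O I) /\ S = sum_via O I B1 A B).

Definition mul (pl : affine_plane) (O I A B : point pl) : point pl :=
  epsilon (inhabits O) (fun S =>
    exists B1 : point pl, ~ on B1 (join O I) /\ S = product_via O I B1 A B).

Definition opp (pl : affine_plane) (O I A : point pl) : point pl :=
  epsilon (inhabits O) (fun Y => on Y (join O I) /\ add O I A Y = O).

Definition sub (pl : affine_plane) (O I A B : point pl) : point pl :=
  add O I A (opp O I B).

(* For A = O this is an unspecified point of the line OI, about which nothing
   else is known. *)
Definition inv (pl : affine_plane) (O I A : point pl) : point pl :=
  epsilon (inhabits O) (fun Y =>
    on Y (join O I) /\
    (A <> O -> mul O I A Y = I /\ mul O I Y A = I)).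

Definition cross_ratio (pl : affine_plane) (O I A B C D : point pl)
    : point pl :=
  mul O I
    (mul O I (inv O I (sub O I A D)) (sub O I B D))
    (mul O I (inv O I (sub O I B C)) (sub O I A C)).

(* Main.v *)
(* A dilation is a map f of the plane such that f X f Y is always parallel to
   XY.  If a dilation f moves every point parallel to OI, then for every choice
   of the auxiliary point B1 the construction of A + B with A = f O yields f B;
   likewise, if f fixes O, the construction of A * B with A = f I yields f B.  So
   both operations are well defined once enough translations and homotheties
   exist, and the laws of addition reduce to composing translations.  Desargues'
   axiom produces the two kinds of dilation by a single argument, applied to a
   pencil of lines that is either a parallel class or all lines through O.  Every
   value of the cross-ratio lies on OI, and mu(C) = O is the neutral element. *)

From Stdlib Require Import Classical ClassicalEpsilon ssreflect.
Require Import Defs.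

(** * Incidence and parallelism in an affine plane *)

Lemma join_unique {pl : affine_plane} (P Q : point pl) (l m : line pl) :
  P <> Q -> on P l -> on Q l -> on P m -> on Q m -> l = m.
Proof.
move=> PQ Pl Ql Pm Qm; case: (unique_join PQ) => n [_ n_unique].
by rewrite -(n_unique l (conj Pl Ql)) -(n_unique m (conj Pm Qm)).
Qed.

Lemma meet_unique {pl : affine_plane} (P Q : point pl) (l m : line pl) :
  l <> m -> on P l -> on Q l -> on P m -> on Q m -> P = Q.
Proof.
by move=> lm Pl Ql Pm Qm; apply: NNPP => PQ; apply: lm; apply: (join_unique P Q).
Qed.

Lemma exists_line_through {pl : affine_plane} (P Q : point pl) :
  exists l, on P l /\ on Q l.
Proof.
have join_ex (R S : point pl) : R <> S -> exists l, on R l /\ on S l.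
  by move=> /unique_join [l [Hl _]]; exists l.
case: (classic (P = Q)) => [<-|]; last exact: join_ex.
case: (noncollinear_triple pl) => [R [S [_ [RS _]]]].
case: (classic (P = R)) => [PR|PR].
  by case: (join_ex P S) => [|l [Pl _]]; [rewrite PR|exists l].
by case: (join_ex P R PR) => l [Pl _]; exists l.
Qed.

Lemma exists_point_off {pl : affine_plane} (l : line pl) : exists P, ~ on P l.
Proof.
apply: NNPP => all_on.
have {}all_on P : on P l by apply: NNPP => Pl; apply: all_on; exists P.
case: (noncollinear_triple pl) => [P [Q [R [_ [_ [_ nc]]]]]].
by apply: nc; exists l.
Qed.

Lemma parallel_refl {pl : affine_plane} (l : line pl) : parallel l l.
Proof. by left. Qed.

Lemma parallel_sym {pl : affine_plane} (l m : line pl) :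
  parallel l m -> parallel m l.
Proof.
by case=> [->|lm]; [left|right=> -[P [? ?]]; apply: lm; exists P].
Qed.

Lemma parallel_common {pl : affine_plane} (P : point pl) (l m : line pl) :
  parallel l m -> on P l -> on P m -> l = m.
Proof. by case=> // lm Pl Pm; case: lm; exists P. Qed.

Lemma exists_parallel {pl : affine_plane} (R : point pl) (l : line pl) :
  exists m, on R m /\ parallel l m.
Proof.
case: (classic (on R l)) => Rl; first by exists l; split=> //; left.
case: (unique_parallel Rl) => m [[Rm lm] _].
by exists m; split=> //; right.
Qed.

(** If [l] and [n] meet at a point [P] off [m], both are the unique parallel to [m] through [P]. *)
Lemma parallel_trans {pl : affine_plane} (l m n : line pl) :
  parallel l m -> parallel m n -> parallel l n.
Proof.
move=> lm mn; apply: NNPP => ln.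
have [P [Pl Pn]] : exists P, on P l /\ on P n.
  by apply: NNPP => ln'; apply: ln; right.
apply: ln; left.
case: (classic (on P m)) => Pm.
  by rewrite (parallel_common P l m lm Pl Pm) (parallel_common P m n mn Pm Pn).
case: (unique_parallel Pm) => k [_ k_unique].
have uniq q : on P q -> parallel m q -> k = q.
  move=> Pq mq; apply: k_unique; split=> //.
  by case: mq Pm => // -> /(_ Pq).
by rewrite -(uniq l Pl (parallel_sym _ _ lm)) -(uniq n Pn mn).
Qed.

Lemma nonparallel_meet {pl : affine_plane} (l m : line pl) :
  ~ parallel l m -> exists P, on P l /\ on P m.
Proof. by move=> lm; apply: NNPP => no; apply: lm; right. Qed.

(** An empty line would be parallel to every line, so by transitivity two lines through one point
    would coincide, against non-collinearity. A second point is then cut out on [l] by a parallel to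
    a line [n] that crosses [l] at [P]. *)
Lemma exists_second_point {pl : affine_plane} (l : line pl) (P : point pl) :
  exists Q, on Q l /\ Q <> P.
Proof.
case: (exists_point_off l) => S Sl.
have [Q Ql] : exists Q, on Q l.
  apply: NNPP => empty.
  have par_l m : parallel l m.
    by right=> -[Q [Ql _]]; apply: empty; exists Q.
  case: (noncollinear_triple pl) => [R [T [U [_ [_ [_ nc]]]]]].
  case: (exists_line_through R T) => m [Rm Tm].
  case: (exists_line_through R U) => n [Rn Un].
  apply: nc; exists m; split=> //; split=> //.
  by rewrite (parallel_common R m n (parallel_trans _ _ _ (parallel_sym _ _ (par_l m)) (par_l n))).
case: (classic (Q = P)) => [QP|]; last by exists Q.
subst Q; case: (exists_line_through P S) => n [Pn Sn].
(* If [l] and [n] covered the plane, [V] would lie on [l], and the fourth vertex [W] of the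
   parallelogram on [P], [S], [V] would be off both lines. *)
have [T Tnl] : exists T, ~ on T n /\ ~ on T l.
  apply: NNPP => cover.
  case: (exists_parallel S l) => m [Sm lm].
  case: (exists_point_off n) => V Vn.
  have Vl : on V l by apply: NNPP => Vl; apply: cover; exists V.
  case: (exists_parallel V n) => q [Vq nq].
  case: (classic (parallel m q)) => mq.
    have lq := parallel_common V l q (parallel_trans _ _ _ lm mq) Vl Vq.
    apply: Sl; rewrite lq.
    by rewrite -(parallel_common P n q nq Pn) // -lq.
  case: (nonparallel_meet _ _ mq) => W [Wm Wq]; apply: cover; exists W.
  split=> [Wn|Wl].
    by apply: Vn; rewrite (parallel_common W n q nq Wn Wq).
  by apply: Sl; rewrite (parallel_common W l m lm Wl Wm).
case: Tnl => Tn Tl.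
case: (exists_parallel T n) => q [Tq nq].
have [Q [Qq Q_l]] : exists Q, on Q q /\ on Q l.
  apply: nonparallel_meet => ql; apply: Sl.
  by rewrite -(parallel_common P n l (parallel_trans _ _ _ nq ql) Pn Ql).
exists Q; split=> // QP; apply: Tn.
by rewrite (parallel_common P n q nq Pn) // -QP.
Qed.

(** * The chosen joins, parallels and meets *)

Lemma on_join {pl : affine_plane} (P Q : point pl) :
  on P (join P Q) /\ on Q (join P Q).
Proof. exact: (epsilon_spec (line_inhabited pl) _ (exists_line_through P Q)). Qed.

Lemma parallel_at_eq {pl : affine_plane} (R : point pl) (l m : line pl) :
  on R m -> parallel l m -> parallel_at R l = m.
Proof.
move=> Rm lm.
have [Rp lp] := epsilon_spec (line_inhabited pl) _ (exists_parallel R l).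
apply: (parallel_common R) => //.
exact: parallel_trans (parallel_sym _ _ lp) lm.
Qed.

Lemma meet_eq {pl : affine_plane} (P : point pl) (l m : line pl) :
  l <> m -> on P l -> on P m -> meet l m = P.
Proof.
move=> lm Pl Pm; have ex := ex_intro (fun P => on P l /\ on P m) P (conj Pl Pm).
have [Ml Mm] := epsilon_spec (point_inhabited pl) _ ex.
exact: (meet_unique _ _ l m).
Qed.

(** * Parallel pairs of points *)

(** Being stated through existing lines, it always holds when [X = Y] or [X' = Y']; transitivity
    therefore asks for a distinct middle pair. *)
Definition pairs_parallel {pl : affine_plane} (X Y X' Y' : point pl) : Prop :=
  exists l m, on X l /\ on Y l /\ on X' m /\ on Y' m /\ parallel l m.

Lemma pairs_parallel_swap {pl : affine_plane} (X Y X' Y' : point pl) :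
  pairs_parallel X Y X' Y' -> pairs_parallel Y X Y' X'.
Proof. by move=> [l [m [? [? [? [? ?]]]]]]; exists l, m. Qed.

Lemma pairs_parallel_trans {pl : affine_plane} (X Y X' Y' X'' Y'' : point pl) :
  X' <> Y' -> pairs_parallel X Y X' Y' -> pairs_parallel X' Y' X'' Y'' ->
  pairs_parallel X Y X'' Y''.
Proof.
move=> X'Y' [l [m [? [? [? [? lm]]]]]] [m' [n [? [? [? [? mn]]]]]].
have E : m = m' by apply: (join_unique X' Y').
by subst m'; exists l, n; do !split=> //; apply: parallel_trans lm mn.
Qed.

Lemma pairs_parallel_on {pl : affine_plane} (X Y X' Y' : point pl) (l : line pl) :
  X <> Y -> on X l -> on Y l -> pairs_parallel X Y X' Y' ->
  exists m, on X' m /\ on Y' m /\ parallel l m.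
Proof.
move=> XY Xl Yl [k [m [Xk [Yk [X'm [Y'm km]]]]]].
by exists m; rewrite (join_unique X Y l k).
Qed.

Lemma pairs_parallel_on_line {pl : affine_plane} (X Y X' Y' : point pl)
    (l m : line pl) :
  X <> Y -> on X l -> on Y l -> pairs_parallel X Y X' Y' ->
  parallel l m -> on X' m -> on Y' m.
Proof.
move=> XY Xl Yl /(pairs_parallel_on _ _ _ _ l XY Xl Yl) [k [X'k [Y'k lk]]] lm X'm.
suff <- : k = m by [].
exact: parallel_common (parallel_trans _ _ _ (parallel_sym _ _ lk) lm) X'k X'm.
Qed.

(** * Pencils of lines and the dilations obtained from Desargues' axiom *)

(** A parallel class has no such point, and the lines through [O] have only [O]; a predicate treats
    both cases alike. *)
Definition center {pl : affine_plane} (pen : line pl -> Prop) (X : point pl) :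
  Prop := forall k, pen k -> on X k.

(* Both the lines through a point and the lines of a parallel class. *)
Definition pencil {pl : affine_plane} (pen : line pl -> Prop) : Prop :=
  (forall X, exists k, pen k /\ on X k) /\
  (forall k m X, pen k -> pen m -> k <> m -> on X k -> on X m -> center pen X).

Definition preserves {pl : affine_plane} (pen : line pl -> Prop)
    (X X' : point pl) : Prop :=
  forall k, pen k -> on X k -> on X' k.

Lemma pencil_line_unique {pl : affine_plane} (pen : line pl -> Prop)
    (X : point pl) (k m : line pl) :
  pencil pen -> ~ center pen X -> pen k -> pen m -> on X k -> on X m -> k = m.
Proof.
move=> [_ pU] cX pk pm Xk Xm; apply: NNPP => km.
by apply: cX; apply: (pU k m).
Qed.

(** The coincidences of lines that the axiom excludes are settled directly; the pencil supplies the
    alternative of parallel or concurrent lines. *)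
Lemma pencil_desargues {pl : affine_plane} (pen : line pl -> Prop)
    (k1 k2 k3 : line pl) (X1 X2 X3 X1' X2' X3' : point pl) :
  desargues_axiom pl -> pencil pen ->
  pen k1 -> pen k2 -> pen k3 -> k1 <> k2 -> k2 <> k3 -> k1 <> k3 ->
  on X1 k1 -> on X1' k1 -> on X2 k2 -> on X2' k2 -> on X3 k3 -> on X3' k3 ->
  ~ center pen X1 -> ~ center pen X2 -> ~ center pen X3 ->
  ~ center pen X1' -> ~ center pen X2' -> ~ center pen X3' ->
  pairs_parallel X1 X2 X1' X2' -> pairs_parallel X2 X3 X2' X3' ->
  pairs_parallel X1 X3 X1' X3'.
Proof.
move=> des pP p1 p2 p3 k12 k23 k13 a1 a1' a2 a2' a3 a3' c1 c2 c3 c1' c2' c3'.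
have only X k m : ~ center pen X -> pen k -> pen m -> k <> m -> on X k -> ~ on X m.
  by move=> cX pk pm km Xk Xm; apply: km; apply: (pencil_line_unique pen X).
have fixed X Y X' k m l : pen k -> pen m -> k <> m -> on X k -> on X' k ->
    on Y m -> ~ center pen Y -> on X l -> on Y l -> on X' l -> X = X'.
  move=> pk pm km Xk X'k Ym cY Xl Yl X'l; apply: NNPP => XX'.
  by apply: (only Y m k) => //; [move=> E; apply: km|
    rewrite (join_unique X X' k l)].
move=> [l [l' [X1l [X2l [X1l' [X2l' ll']]]]]] [m [m' [X2m [X3m [X2m' [X3m' mm']]]]]].
have nE (a b : line pl) : a <> b -> b <> a by move=> ab E; apply: ab.
have refl X Y : pairs_parallel X Y X Y.
  by case: (exists_line_through X Y) => n [? ?]; exists n, n; do !split=> //; left.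
(* If [l = l'], then [X1] and [X1'] lie both on [l] and on [k1], so they agree, and likewise [X2]
   and [X2']; then [m = m'], and [X3] agrees with [X3']. *)
case: (classic (l = l')) => [E|ll'n].
  subst l'.
  have E1 : X1 = X1' by apply: (fixed _ X2 _ k1 k2 l).
  have E2 : X2 = X2' by apply: (fixed _ X1 _ k2 k1 l) => //; apply: nE.
  subst X1' X2'; have E := parallel_common X2 m m' mm' X2m X2m'; subst m'.
  have <- : X3 = X3' by apply: (fixed _ X2 _ k3 k2 m) => //; apply: nE.
  exact: refl.
case: (classic (m = m')) => [E|mm'n].
  subst m'.
  have E3 : X3 = X3' by apply: (fixed _ X2 _ k3 k2 m) => //; apply: nE.
  have E2 : X2 = X2' by apply: (fixed _ X3 _ k2 k3 m).
  subst X3' X2'; have E := parallel_common X2 l l' ll' X2l X2l'; subst l'.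
  by [].
case: (exists_line_through X1 X3) => n [X1n X3n].
case: (exists_line_through X1' X3') => n' [X1n' X3n'].
exists n, n'; do !split=> //.
case: (classic (n = n')) => [->|nn'n]; first by left.
have X13 : X1 <> X3 by move=> E; apply: (only X1 k1 k3) => //; rewrite E.
have X13' : X1' <> X3' by move=> E; apply: (only X1' k1 k3) => //; rewrite E.
(* A line joining non-central points of [k1] and [k3] is not in the pencil; with [n <> n'] this
   makes the five lines distinct. *)
have off_n k q Y1 Y3 : pen k -> on Y1 k1 -> on Y3 k3 -> ~ center pen Y1 ->
    ~ center pen Y3 -> on Y1 q -> on Y3 q -> k <> q.
  move=> pk y1 y3 cy1 cy3 y1q y3q E; subst q.
  case: (classic (k1 = k)) => [E|E]; first by subst k; apply: (only Y3 k3 k1) => //; apply: nE.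
  by apply: (only Y1 k1 k).
apply: (des X1 X2 X3 X1' X2' X3' k1 k2 k3 l l' m m') => //.
  have offn k (pk : pen k) : k <> n := off_n k n X1 X3 pk a1 a3 c1 c3 X1n X3n.
  have offn' k (pk : pen k) : k <> n' := off_n k n' X1' X3' pk a1' a3' c1' c3' X1n' X3n'.
  have := (offn _ p1, offn _ p2, offn _ p3, offn' _ p1, offn' _ p2, offn' _ p3).
  by move=> *; repeat constructor; cbn; intuition.
(* Two distinct lines of the pencil can meet only at a center, which lies on all three lines;
   failing that, they are pairwise disjoint. *)
case: (classic (exists P, on P k1 /\ on P k2 /\ on P k3)) => conc; [by right|left].
case: pP => _ pU.
by do !split; right=> -[P [Pa Pb]]; apply: conc; exists P;
  have cP := pU _ _ P _ _ _ Pa Pb; do !split=> //; apply: cP.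
Qed.

Lemma pencil_transfer {pl : affine_plane} (pen : line pl -> Prop)
    (k : line pl) (A A' X : point pl) :
  pencil pen -> pen k -> on A k -> on A' k ->
  ~ center pen A -> ~ center pen A' -> ~ on X k ->
  exists X', preserves pen X X' /\ pairs_parallel A X A' X'.
Proof.
move=> pP pk Ak A'k cA cA' Xk.
have cX : ~ center pen X by move=> /(_ k pk).
case: (exists_line_through A X) => n [An Xn].
case: (exists_parallel A' n) => n' [A'n' nn'].
case: (pP) => /(_ X) [m [pm Xm]] _.
have mn' : ~ parallel m n'.
  move=> mn'; apply: Xk.
  have E := parallel_common X m n (parallel_trans _ _ _ mn' (parallel_sym _ _ nn')) Xm Xn.
  by subst n; rewrite (pencil_line_unique pen A k m).
case: (nonparallel_meet _ _ mn') => X' [X'm X'n'].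
exists X'; split; last by exists n, n'.
by move=> q pq Xq; rewrite (pencil_line_unique pen X q m).
Qed.

Lemma pencil_transfer_unique {pl : affine_plane} (pen : line pl -> Prop)
    (k m : line pl) (A A' X X1 X2 : point pl) :
  pencil pen -> pen k -> pen m -> on A k -> on A' k ->
  ~ center pen A -> ~ on X k -> on X m -> on X1 m -> on X2 m ->
  pairs_parallel A X A' X1 -> pairs_parallel A X A' X2 -> X1 = X2.
Proof.
move=> pP pk pm Ak A'k cA Xk Xm X1m X2m [n [n1 [An [Xn [A'n1 [X1n1 nn1]]]]]] H2.
have AX : A <> X by move=> E; apply: Xk; rewrite -E.
have X2n1 := pairs_parallel_on_line _ _ _ _ _ _ AX An Xn H2 nn1 A'n1.
apply: (meet_unique _ _ m n1) => // E; subst n1; apply: Xk.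
have E := parallel_common X n m nn1 Xn Xm; subst n.
by rewrite (pencil_line_unique pen A k m).
Qed.

(** If [X'] were a center, the line [A'X'] would be [k], and so would its parallel [AX]. *)
Lemma pencil_transfer_noncenter {pl : affine_plane} (pen : line pl -> Prop)
    (k : line pl) (A A' X X' : point pl) :
  pencil pen -> pen k -> on A k -> on A' k ->
  ~ center pen A -> ~ center pen A' -> ~ on X k ->
  pairs_parallel A X A' X' -> ~ center pen X'.
Proof.
move=> pP pk Ak A'k cA cA' Xk H cX'.
have AX : A <> X by move=> E; apply: Xk; rewrite -E.
have A'X' : A' <> X' by move=> E; apply: cA'; rewrite E.
case: H => n [n' [An [Xn [A'n' [X'n' nn']]]]]; apply: Xk.
have E : n' = k by apply: (join_unique A' X') => //; apply: cX'.
by subst n'; rewrite -(parallel_common A n k nn').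
Qed.

Lemma pencil_transfer_moves {pl : affine_plane} (k : line pl) (A A' X : point pl) :
  on A k -> on A' k -> A <> A' -> ~ on X k -> ~ pairs_parallel A X A' X.
Proof.
move=> Ak A'k AA' Xk [n [n' [An [Xn [A'n' [Xn' nn']]]]]]; apply: Xk.
have E := parallel_common X n n' nn' Xn Xn'; subst n'.
by rewrite (join_unique A A' k n).
Qed.

(* In the affine plane of order 2 a parallel class has no third line to serve as
   an intermediary for Desargues' axiom; this lemma replaces it there. *)
Lemma pairs_parallel_two_lines {pl : affine_plane} (pen : line pl -> Prop)
    (k m : line pl) (X X' Y Y' : point pl) :
  pencil pen -> pen k -> pen m -> (forall q, pen q -> q = k \/ q = m) ->
  on X k -> on X' k -> on Y m -> on Y' m -> ~ on X m -> ~ on Y k ->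
  ~ on X' m -> ~ on Y' k ->
  X <> X' -> Y <> Y' -> pairs_parallel X Y X' Y'.
Proof.
move=> [cover _] pk pm two Xk X'k Ym Y'm Xm Yk X'm Y'k XX' YY'.
case: (exists_line_through X Y) => n [Xn Yn].
case: (exists_line_through X' Y') => n' [X'n' Y'n'].
exists n, n'; do !split=> //; right=> -[Q [Qn Qn']].
case: (cover Q) => q [/two [|] -> Qq].
  apply: XX'; transitivity Q; [apply: (meet_unique _ _ k n) | apply: (meet_unique _ _ k n')] => // E.
    by apply: Yk; rewrite E.
  by apply: Y'k; rewrite E.
apply: YY'; transitivity Q; [apply: (meet_unique _ _ m n) | apply: (meet_unique _ _ m n')] => // E.
  by apply: Xm; rewrite E.
by apply: X'm; rewrite E.
Qed.

(* Constant maps satisfy this too; the one with value O serves as the homothety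
   of ratio zero. *)
Definition dilation {pl : affine_plane} (f : point pl -> point pl) : Prop :=
  forall X Y, pairs_parallel X Y (f X) (f Y).

Lemma dilation_id (pl : affine_plane) : dilation (fun X : point pl => X).
Proof.
move=> X Y; case: (exists_line_through X Y) => l [Xl Yl].
by exists l, l; do !split=> //; left.
Qed.

(** Points off [k0] are transferred from the pair [X0], [X0']. Points of [k0] are out of its reach
    and are transferred from [Y0], [Y0'], where [Y0] is off [k0] and [Y0'] is its own transfer.
    Desargues' axiom shows that the two rules fit together. *)
Lemma pencil_dilation {pl : affine_plane} (pen : line pl -> Prop)
    (k0 : line pl) (X0 X0' : point pl) :
  desargues_axiom pl -> pencil pen -> pen k0 -> on X0 k0 -> on X0' k0 ->
  ~ center pen X0 -> ~ center pen X0' ->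
  exists f, dilation f /\ f X0 = X0' /\ forall X, preserves pen X (f X).
Proof.
move=> des pP pk0 X0k X0'k cX0 cX0'.
case: (classic (X0 = X0')) => [<-|X00'].
  by exists (fun X => X); split; [apply: dilation_id | split=> // X k].
case: (exists_point_off k0) => Y0 Y0k.
case: (pencil_transfer _ _ _ _ _ pP pk0 X0k X0'k cX0 cX0' Y0k) => Y0' [Y0Y0' Y0par].
have cY0 : ~ center pen Y0 by move=> /(_ _ pk0).
have cY0' := pencil_transfer_noncenter _ _ _ _ _ _ pP pk0 X0k X0'k cX0 cX0' Y0k Y0par.
have only X k m : ~ center pen X -> pen k -> pen m -> k <> m -> on X k -> ~ on X m.
  by move=> cX pk pm km Xk Xm; apply: km; apply: (pencil_line_unique pen X).
case: (pP) => cover _.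
case: (cover Y0) => kY [pkY Y0kY].
have Y0'kY : on Y0' kY by apply: Y0Y0'.
have k0kY : k0 <> kY by move=> E; apply: Y0k; rewrite E.
have kYk0 : kY <> k0 by move=> E; apply: k0kY.
have image X : exists X', preserves pen X X' /\
    (~ on X k0 -> pairs_parallel X0 X X0' X') /\
    (on X k0 -> pairs_parallel Y0 X Y0' X').
  case: (classic (on X k0)) => Xk.
    case: (classic (center pen X)) => cX.
      exists X; split=> //; split=> // _.
      by exists kY, kY; do !split=> //; [apply: cX|apply: cX|left].
    have XkY : ~ on X kY by apply: (only X k0).
    case: (pencil_transfer _ _ _ _ _ pP pkY Y0kY Y0'kY cY0 cY0' XkY) => X' [? ?].
    by exists X'; split=> //; split.
  case: (pencil_transfer _ _ _ _ _ pP pk0 X0k X0'k cX0 cX0' Xk) => X' [? ?].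
  by exists X'; split=> //; split.
pose f X := proj1_sig (constructive_indefinite_description _ (image X)).
have fpres X : preserves pen X (f X).
  by rewrite /f; case: constructive_indefinite_description => X' [].
have foff X : ~ on X k0 -> pairs_parallel X0 X X0' (f X).
  by rewrite /f; case: constructive_indefinite_description => X' [? []].
have fon X : on X k0 -> pairs_parallel Y0 X Y0' (f X).
  by rewrite /f; case: constructive_indefinite_description => X' [? []].
have noncenter X : ~ center pen X -> ~ center pen (f X).
  move=> cX; case: (classic (on X k0)) => Xk.
    apply: (pencil_transfer_noncenter _ kY Y0 Y0' X) => //; first exact: (only X k0).
    exact: fon.
  by apply: (pencil_transfer_noncenter _ k0 X0 X0' X) => //; apply: foff.
(* Needed when the pencil has only two lines. *)
have moves X : ~ center pen X -> X <> f X.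
  move=> cX; case: (classic (on X k0)) => Xk E.
    apply: (pencil_transfer_moves kY Y0 Y0' X) => //; last by rewrite {2}E; apply: fon.
      by move=> E0; apply: (pencil_transfer_moves k0 X0 X0' Y0) => //; rewrite {2}E0.
    exact: (only X k0).
  by apply: (pencil_transfer_moves k0 X0 X0' X) => //; rewrite {2}E; apply: foff.
(* As a point of [k0], [X0] has its image defined through [Y0]; uniqueness of the transfer
   identifies that image with [X0']. *)
have fX0 : f X0 = X0'.
  apply: (pencil_transfer_unique pen kY k0 Y0 Y0' X0) => //.
  exact: (only X0 k0).
  exact: fpres.
  exact: fon.
  exact: pairs_parallel_swap.
have both_off X Y k m : pen k -> pen m -> k <> m -> on X k -> on Y m ->
    ~ on X k0 -> ~ on Y k0 -> pairs_parallel X Y (f X) (f Y).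
  move=> pk pm km Xk Ym Xk0 Yk0.
  have cX : ~ center pen X by move=> /(_ _ pk0).
  have cY : ~ center pen Y by move=> /(_ _ pk0).
  apply: (pencil_desargues pen k k0 m X X0 Y _ X0') => //; try exact: noncenter;
    try exact: fpres.
  by move=> E; apply: Xk0; rewrite -E.
  by move=> E; apply: Yk0; rewrite E.
  exact/pairs_parallel_swap/foff.
  exact: foff.
have one_on X Y m : pen m -> k0 <> m -> on X k0 -> on Y m -> ~ center pen X ->
    ~ center pen Y -> pairs_parallel X Y (f X) (f Y).
  move=> pm k0m Xk0 Ym cX cY.
  have mk0 : m <> k0 by move=> E; apply: k0m.
  have Yk0 : ~ on Y k0 by apply: (only Y m).
  (* The pair [Z], [Y] lies off [k0] and is already settled, so a [Z] on a third line passes the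
     parallelism on from [X], [Z] to [X], [Y]. *)
  have via Z n : pen n -> k0 <> n -> n <> m -> on Z n -> ~ center pen Z ->
      pairs_parallel X Z (f X) (f Z) -> pairs_parallel X Y (f X) (f Y).
    move=> pn k0n nm Zn cZ XZ.
    have Zk0 : ~ on Z k0 by apply: (only Z n) => // E; apply: k0n.
    apply: (pencil_desargues pen k0 n m X Z Y _ (f Z)) => //; try exact: noncenter;
      try exact: fpres.
    exact: (both_off Z Y n m).
  have fY0 : f Y0 = Y0'.
    apply: (pencil_transfer_unique pen k0 kY X0 X0' Y0) => //; [exact: fpres|exact: foff].
  have XY0 : pairs_parallel X Y0 (f X) (f Y0).
    by rewrite fY0; apply/pairs_parallel_swap/fon.
  case: (classic (kY = m)) => [E|kYm]; last exact: (via Y0 kY).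
  subst m.
  (* Here [Y] is on the line of [Y0], so [Y0] cannot be the intermediate point; a [Z] on a third
     line [q] can, and its own pair with [X] is obtained through [Y0]. *)
  case: (classic (exists q, pen q /\ q <> k0 /\ q <> kY)) => [[q [pq [qk0 qkY]]]|two].
    have [Z [Zq cZ]] : exists Z, on Z q /\ ~ center pen Z.
      case: (classic (exists P, center pen P)) => [[P cP]|nc].
        case: (exists_second_point q P) => Z [Zq ZP]; exists Z; split=> // cZ.
        by apply: qk0; apply: (join_unique Z P) => //; [apply: cP|apply: cZ|apply: cP].
      case: (exists_second_point q Y0) => Z [Zq _]; exists Z; split=> // cZ.
      by apply: nc; exists Z.
    have k0q : k0 <> q by move=> E; apply: qk0.
    have Zk0 : ~ on Z k0 by apply: (only Z q).
    have kYq : kY <> q by move=> E; apply: qkY.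
    apply: (via Z q) => //.
    apply: (pencil_desargues pen k0 kY q X Y0 Z _ (f Y0)) => //; try exact: noncenter;
      try exact: fpres.
    exact: (both_off Y0 Z kY q).
  have fXk0 := fpres X _ pk0 Xk0; have fYkY := fpres Y _ pkY Ym.
  apply: (pairs_parallel_two_lines pen k0 kY) => //; try exact: moves.
  move=> q pq; case: (classic (q = k0)) => [->|qk0]; first by left.
    by right; apply: NNPP => qkY; apply: two; exists q.
  exact: (only X k0).
  by apply: (only (f X) k0) => //; apply: noncenter.
  by apply: (only (f Y) kY) => //; apply: noncenter.
exists f; split=> //.
move=> X Y.
case: (cover X) => k [pk Xk]; case: (cover Y) => m [pm Ym].
have trivial q : pen q -> on X q -> on Y q -> pairs_parallel X Y (f X) (f Y).
  by move=> pq Xq Yq; exists q, q; do !split=> //; [apply: fpres|apply: fpres|left].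
case: (classic (center pen X)) => cX; first by apply: (trivial m) => //; apply: cX.
case: (classic (center pen Y)) => cY; first by apply: (trivial k) => //; apply: cY.
case: (classic (k = m)) => [E|km]; first by subst m; apply: (trivial k).
case: (classic (on X k0)) => Xk0; case: (classic (on Y k0)) => Yk0.
- exact: (trivial k0).
- by apply: (one_on X Y m) => // E; apply: Yk0; rewrite E.
- apply: pairs_parallel_swap.
  by apply: (one_on Y X k) => // E; apply: Xk0; rewrite E.
- exact: (both_off X Y k m).
Qed.

(** * Translations and homotheties *)

(** The identity is included; constant maps are not, since no point lies on all lines of a parallel
    class. *)
Definition translation_along {pl : affine_plane} (l : line pl)
    (f : point pl -> point pl) : Prop :=
  dilation f /\ forall X, preserves (parallel l) X (f X).

Lemma dilation_comp {pl : affine_plane} (f g : point pl -> point pl) :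
  dilation f -> dilation g -> dilation (fun X => f (g X)).
Proof.
move=> df dg X Y; case: (classic (g X = g Y)) => gXY.
  (* The middle pair determines no direction, but the image pair is a single point, through which
     every line has a parallel. *)
  rewrite -gXY; case: (exists_line_through X Y) => l [Xl Yl].
  case: (exists_parallel (f (g X)) l) => m [? ?].
  by exists l, m.
exact: pairs_parallel_trans gXY (dg X Y) (df _ _).
Qed.

Lemma dilation_on {pl : affine_plane} (f : point pl -> point pl)
    (X Y : point pl) (l m : line pl) :
  dilation f -> on X l -> on Y l -> parallel l m -> on (f X) m -> on (f Y) m.
Proof.
move=> df Xl Yl lm fXm; case: (classic (X = Y)) => [<- //|XY].
exact: pairs_parallel_on_line XY Xl Yl (df X Y) lm fXm.
Qed.

(** Lines through a fixed point are invariant, so a point off [PQ] is fixed as the intersection of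
    two of them. For a point on [PQ], a fixed point off [PQ] takes the place of [Q]. *)
Lemma dilation_fix2 {pl : affine_plane} (f : point pl -> point pl)
    (P Q : point pl) :
  dilation f -> P <> Q -> f P = P -> f Q = Q -> forall X, f X = X.
Proof.
move=> df.
have line_fixed P0 X l : f P0 = P0 -> on P0 l -> on X l -> on (f X) l.
  move=> fP Pl Xl; apply: (dilation_on f P0 X l l) => //; first by left.
  by rewrite fP.
have off P0 Q0 l X : P0 <> Q0 -> f P0 = P0 -> f Q0 = Q0 -> on P0 l -> on Q0 l ->
    ~ on X l -> f X = X.
  move=> PQ fP fQ Pl Ql Xl.
  case: (exists_line_through P0 X) => m [Pm Xm].
  case: (exists_line_through Q0 X) => n [Qn Xn].
  apply: (meet_unique _ _ m n) => //.
  by move=> E; subst n; apply: Xl; rewrite (join_unique P0 Q0 l m).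
  exact: (line_fixed P0).
  exact: (line_fixed Q0).
move=> PQ fP fQ X.
case: (exists_line_through P Q) => l [Pl Ql].
case: (classic (on X l)) => Xl; last exact: (off P Q l).
case: (exists_point_off l) => Z Zl.
have fZ := off P Q l Z PQ fP fQ Pl Ql Zl.
case: (classic (X = P)) => [-> //|XP].
case: (exists_line_through P Z) => m [Pm Zm].
apply: (off P Z m) => //; first by move=> E; apply: Zl; rewrite -E.
by move=> Xm; apply: Zl; rewrite (join_unique X P l m).
Qed.

Lemma pencil_parallel {pl : affine_plane} (l : line pl) : pencil (parallel l).
Proof.
split=> [X|k m X lk lm km Xk Xm].
  by case: (exists_parallel X l) => k [Xk lk]; exists k.
case: km; apply: (parallel_common X) => //.
exact: parallel_trans (parallel_sym _ _ lk) lm.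
Qed.

Lemma pencil_point {pl : affine_plane} (O : point pl) :
  pencil (fun k : line pl => on O k).
Proof.
split=> [X|k m X Ok Om km Xk Xm n On]; first exact: exists_line_through.
by rewrite (meet_unique X O k m).
Qed.

Lemma exists_translation {pl : affine_plane} (l : line pl) (A A' : point pl) :
  desargues_axiom pl -> on A l -> on A' l ->
  exists f, translation_along l f /\ f A = A'.
Proof.
move=> des Al A'l.
have nc X : ~ center (parallel l) X.
  move=> cX; case: (exists_point_off l) => P Pl.
  case: (exists_parallel P l) => m [Pm lm].
  apply: Pl; rewrite (parallel_common X l m lm) //; apply: cX => //; by left.
have [f [df [fA fX]]] := pencil_dilation _ l A A' des (pencil_parallel l)
  (parallel_refl l) Al A'l (nc A) (nc A').
by exists f.
Qed.

Lemma exists_homothety {pl : affine_plane} (l : line pl) (O A A' : point pl) :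
  desargues_axiom pl -> O <> A -> on O l -> on A l -> on A' l ->
  exists f, dilation f /\ f O = O /\ f A = A'.
Proof.
move=> des OA Ol Al A'l.
case: (classic (O = A')) => [<-|OA'].
  exists (fun _ => O); split=> // X Y.
  case: (exists_line_through X Y) => m [Xm Ym].
  by case: (exists_parallel O m) => n [On mn]; exists m, n.
case: (exists_point_off l) => P Pl.
case: (exists_line_through O P) => m [Om Pm].
have lm : l <> m by move=> E; apply: Pl; rewrite E.
have only X : center (fun k => on O k) X -> O = X.
  by move=> cX; apply: (meet_unique _ _ l m) => //; apply: cX.
have [f [df [fA fX]]] := pencil_dilation _ l A A' des (pencil_point O)
  Ol Al A'l (fun cA => OA (only A cA)) (fun cA => OA' (only A' cA)).
exists f; split=> //; split=> //.
(* [f O] lies on every line through [O], because [f] preserves this pencil. *)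
by rewrite -(only (f O)) // => k Ok; apply: fX.
Qed.

(** * Sums and products as values of dilations *)

(** For every [B1] the intermediate point is [f B1]: it is on the parallel to [join O I] through
    [B1] because [f] moves points along that direction, and on the parallel to [join O B1] through
    [f O] because [f] is a dilation. *)
Lemma addE {pl : affine_plane} (O I B : point pl) (f : point pl -> point pl) :
  O <> I -> translation_along (join O I) f -> on B (join O I) ->
  add O I (f O) B = f B.
Proof.
move=> OI [df tf] Bl; have [Ol Il] := on_join O I.
have f_l X : on X (join O I) -> on (f X) (join O I) by apply: tf; left.
have ref_l := parallel_refl (join O I).
have via B1 : ~ on B1 (join O I) -> sum_via O I B1 (f O) B = f B.
  move=> B1l; rewrite /sum_via.
  have nl P m : on P (join O I) -> on P m -> on B1 m -> ~ parallel (join O I) m.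
    by move=> Pl Pm B1m lm; apply: B1l; rewrite (parallel_common P _ m lm).
  have [Oj B1j] := on_join O B1; have [Bj B1j'] := on_join B B1.
  case: (exists_parallel B1 (join O I)) => m [B1m lm].
  case: (exists_parallel (f O) (join O B1)) => n [fOn jn].
  rewrite (parallel_at_eq B1 _ m) // (parallel_at_eq (f O) _ n) //.
  rewrite (meet_eq (f B1) m n).
  move=> E; subst n; apply: (nl O (join O B1)) => //.
    exact: parallel_trans lm (parallel_sym _ _ jn).
  exact: tf.
  exact: (dilation_on f O B1 (join O B1)).
  case: (exists_parallel (f B1) (join B B1)) => q [fB1q jq].
  rewrite (parallel_at_eq (f B1) _ q) //; apply: meet_eq.
  by move=> E; subst q; apply: (nl B (join B B1)) => //; apply: parallel_sym.
  exact: (dilation_on f B1 B (join B B1)).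
  exact: f_l.
rewrite /add.
case: (exists_point_off (join O I)) => B1 B1l.
have [B2 [B2l ->]] := epsilon_spec (inhabits O) (fun S =>
    exists B1 : point pl, ~ on B1 (join O I) /\ S = sum_via O I B1 (f O) B)
  (ex_intro _ _ (ex_intro _ B1 (conj B1l eq_refl))).
exact: via.
Qed.

(** The intermediate point is again [f B1]; it stays on [join O B1] because [f] fixes [O] and so
    maps lines through [O] into themselves. *)
Lemma mulE {pl : affine_plane} (O I B : point pl) (f : point pl -> point pl) :
  O <> I -> dilation f -> f O = O -> on B (join O I) ->
  mul O I (f I) B = f B.
Proof.
move=> OI df fO Bl; have [Ol Il] := on_join O I.
have f_l X m : on O m -> on X m -> on (f X) m.
  move=> Om Xm; apply: (dilation_on f O X m) => //; first by left.
  by rewrite fO.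
have via B1 : ~ on B1 (join O I) -> product_via O I B1 (f I) B = f B.
  move=> B1l; rewrite /product_via.
  have [Oj B1j] := on_join O B1; have [Bj B1j'] := on_join B B1.
  have [Ij B1j''] := on_join I B1.
  case: (exists_parallel (f I) (join I B1)) => n [fIn jn].
  rewrite (parallel_at_eq (f I) _ n) //.
  rewrite (meet_eq (f B1) n (join O B1)).
  move=> E; subst n; apply: B1l.
    have E := parallel_common B1 _ _ jn B1j'' B1j.
    by rewrite (join_unique O I (join O I) (join O B1)) // -E.
  exact: (dilation_on f I B1 (join I B1)).
  exact: f_l.
  case: (exists_parallel (f B1) (join B B1)) => q [fB1q jq].
  rewrite (parallel_at_eq (f B1) _ q) //; apply: meet_eq.
  move=> E; subst q; apply: B1l.
    by rewrite -(parallel_common B _ _ jq).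
  exact: (dilation_on f B1 B (join B B1)).
  exact: f_l.
rewrite /mul.
case: (exists_point_off (join O I)) => B1 B1l.
have [B2 [B2l ->]] := epsilon_spec (inhabits O) (fun S =>
    exists B1 : point pl, ~ on B1 (join O I) /\ S = product_via O I B1 (f I) B)
  (ex_intro _ _ (ex_intro _ B1 (conj B1l eq_refl))).
exact: via.
Qed.

(** * Composition and commutation of translations *)

Lemma translation_comp {pl : affine_plane} (l : line pl)
    (f g : point pl -> point pl) :
  translation_along l f -> translation_along l g ->
  translation_along l (fun X => f (g X)).
Proof.
move=> [df tf] [dg tg]; split; first exact: dilation_comp.
by move=> X k lk Xk; apply: tf => //; apply: tg.
Qed.

(** A point [Q] off the parallel to [l] through [P] stays on the invariant line [PQ] and on its own
    parallel to [l], so it is a second fixed point. *)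
Lemma translation_fix {pl : affine_plane} (l : line pl)
    (f : point pl -> point pl) (P : point pl) :
  translation_along l f -> f P = P -> forall X, f X = X.
Proof.
move=> [df tf] fP.
case: (exists_parallel P l) => k [Pk lk].
case: (exists_point_off k) => Q Qk.
have PQ : P <> Q by move=> E; apply: Qk; rewrite -E.
apply: (dilation_fix2 f P Q) => //.
case: (exists_parallel Q l) => m [Qm lm].
case: (exists_line_through P Q) => n [Pn Qn].
apply: (meet_unique _ _ m n) => //.
- move=> E; subst n; apply: Qk.
  by rewrite (parallel_common P k m (parallel_trans _ _ _ (parallel_sym _ _ lk) lm)).
- exact: tf.
- by apply: (dilation_on f P Q n) => //; [left|rewrite fP].
Qed.

(** Both sides are the intersection of the parallel to [l] through [g X] with the parallel to [m]
    through [f X]. *)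
Lemma translation_commute {pl : affine_plane} (l m : line pl)
    (f g : point pl -> point pl) :
  ~ parallel l m -> translation_along l f -> translation_along m g ->
  forall X, f (g X) = g (f X).
Proof.
move=> lm [df tf] [dg tg] X.
have image (h : point pl -> point pl) k n h' Y : dilation h -> (forall Z, preserves (parallel k) Z (h' Z)) ->
    parallel k n -> on (h Y) n -> on (h (h' Y)) n.
  move=> dh th' kn hYn; case: (exists_parallel Y k) => q [Yq kq].
  apply: (dilation_on h Y (h' Y) q) => //; first exact: th'.
  exact: parallel_trans (parallel_sym _ _ kq) kn.
case: (exists_parallel (g X) l) => k [gXk lk].
case: (exists_parallel (f X) m) => n [fXn mn].
apply: (meet_unique _ _ k n).
- move=> E; subst n; apply: lm.
  exact: parallel_trans lk (parallel_sym _ _ mn).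
- exact: tf.
- exact: (image g l k f X).
- exact: (image f m n g X).
- exact: tg.
Qed.

(** The line through [X] and [f X] is invariant, as is [l]; if they were not parallel, their
    intersection would be fixed. *)
Lemma fixpoint_free_dilation {pl : affine_plane} (l : line pl) (P : point pl)
    (f : point pl -> point pl) :
  dilation f -> (forall X, f X <> X) -> on P l -> on (f P) l ->
  translation_along l f.
Proof.
move=> df nofix Pl fPl; split=> // X k lk Xk.
case: (exists_line_through X (f X)) => m [Xm fXm].
have invariant Y n : on Y n -> on (f Y) n -> forall Z, on Z n -> on (f Z) n.
  by move=> Yn fYn Z Zn; apply: (dilation_on f Y Z n) => //; left.
case: (classic (parallel l m)) => lm.
  by rewrite (parallel_common X k m (parallel_trans _ _ _ (parallel_sym _ _ lk) lm)).
case: (nonparallel_meet _ _ lm) => Z [Zl Zm].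
case: (nofix Z); apply: (meet_unique _ _ l m) => //.
- by move=> E; apply: lm; left.
- exact: (invariant P).
- exact: (invariant X).
Qed.

(** * Arithmetic on the line through [O] and [I] *)

Section LineArithmetic.

Variables (pl : affine_plane) (des : desargues_axiom pl) (O I : point pl).
Hypothesis OI : O <> I.

Let l := join O I.
Let Ol : on O l := proj1 (on_join O I).
Let Il : on I l := proj2 (on_join O I).

Lemma translation_to (A : point pl) :
  on A l -> exists f, translation_along l f /\ f O = A.
Proof. by move=> Al; apply: exists_translation. Qed.

Lemma translation_on (f : point pl -> point pl) (A : point pl) :
  translation_along l f -> on A l -> on (f A) l.
Proof. by move=> [_ tf]; apply: tf; left. Qed.

Lemma add_on (A B : point pl) : on A l -> on B l -> on (add O I A B) l.
Proof.
move=> /translation_to [f [tf <-]] Bl.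
by rewrite addE //; apply: translation_on.
Qed.

Lemma addA (A B C : point pl) : on A l -> on B l -> on C l ->
  add O I (add O I A B) C = add O I A (add O I B C).
Proof.
move=> /translation_to [f [tf <-]] /translation_to [g [tg <-]] Cl.
rewrite (addE O I C g) // !(addE O I _ f) //; try exact: translation_on.
by rewrite (addE O I C (fun X => f (g X))) //; apply: translation_comp.
Qed.

Lemma addr0 (A : point pl) : on A l -> add O I A O = A.
Proof. by move=> /translation_to [f [tf <-]]; rewrite addE. Qed.

Lemma add0r (A : point pl) : on A l -> add O I O A = A.
Proof.
move=> Al; apply: (addE O I A (fun X => X)) => //.
by split; [apply: dilation_id|move=> X k].
Qed.

Lemma addC (A B : point pl) : on A l -> on B l -> add O I A B = add O I B A.
Proof.
move=> Al Bl; case: (classic (O = B)) => [<-|OB]; first by rewrite addr0 // add0r.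
(* The translation O |-> B is written as a composite c \o e of translations off
   the direction l; each of them commutes with translations along l. *)
case: (exists_point_off l) => P Pl.
case: (exists_line_through O P) => m [Om Pm].
case: (exists_line_through P B) => n [Pn Bn].
have mn : ~ parallel m n.
  move=> mn; have E := parallel_common P m n mn Pm Pn; subst n.
  by apply: Pl; rewrite (join_unique O B l m).
have lm : ~ parallel l m.
  by move=> lm; apply: Pl; rewrite (parallel_common O l m lm).
have ln : ~ parallel l n.
  by move=> ln; apply: Pl; rewrite (parallel_common B l n ln).
have [e [te eO]] := exists_translation m O P des Om Pm.
have [c [tc cP]] := exists_translation n P B des Pn Bn.
have tce : translation_along l (fun X => c (e X)).
  apply: (fixpoint_free_dilation l O) => //; last by rewrite eO cP.
    by apply: dilation_comp; [case: tc|case: te].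
  (* If [c] took [e X] back to [X], both points would lie on a parallel to [m] and on a parallel to
     [n]; so [e] would fix [X] and be the identity, although [e O = P]. *)
  move=> X ceX.
  case: (exists_parallel X m) => k [Xk mk].
  case: (exists_parallel (e X) n) => q [eXq nq].
  have : e X = X.
    apply: (meet_unique _ _ k q) => //.
    move=> E; subst q; apply: mn.
      exact: parallel_trans mk (parallel_sym _ _ nq).
    by case: te => _; apply.
    by rewrite -{1}ceX; case: tc => _; apply.
  move=> /(translation_fix m e X te) /(_ O); rewrite eO => PO.
  by apply: Pl; rewrite PO.
case: (translation_to A Al) => f [tf fO].
have addA' : add O I A B = f B by rewrite -fO addE.
have -> : add O I B A = c (e A).
  by rewrite -(addE O I A (fun X => c (e X))) // eO cP.
rewrite addA' -cP -eO (translation_commute l n f c) //.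
by rewrite (translation_commute l m f e) // fO.
Qed.

Lemma oppP (A : point pl) :
  on A l -> on (opp O I A) l /\ add O I A (opp O I A) = O.
Proof.
move=> Al; apply: (epsilon_spec (inhabits O)
  (fun Y => on Y (join O I) /\ add O I A Y = O)).
case: (translation_to A Al) => f [tf fO].
have [g [tg gA]] := exists_translation l A O des Al Ol.
(* [g] takes [A] to [O], so [f] after [g] fixes [A] and is the identity; hence [f (g O) = O]. *)
exists (g O); split; first exact: translation_on.
rewrite -{1}fO (addE O I _ f) //; first exact: translation_on.
apply: (translation_fix l _ A (translation_comp l f g tf tg)).
by rewrite gA.
Qed.

Lemma homothety_on (f : point pl -> point pl) (A : point pl) :
  dilation f -> f O = O -> on A l -> on (f A) l.
Proof.
move=> df fO Al; apply: (dilation_on f O A l) => //; first by left.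
by rewrite fO.
Qed.

Lemma mul_on (A B : point pl) : on A l -> on B l -> on (mul O I A B) l.
Proof.
move=> Al Bl; have [f [df [fO <-]]] := exists_homothety l O I A des OI Ol Il Al.
by rewrite mulE //; apply: homothety_on.
Qed.

Lemma mulr0 (A : point pl) : on A l -> mul O I A O = O.
Proof.
move=> Al; have [f [df [fO <-]]] := exists_homothety l O I A des OI Ol Il Al.
by rewrite mulE.
Qed.

(** The chosen point is known to lie on the line only once some point meets its specification, so
    two-sided inverses are constructed here. *)
Lemma inv_on (A : point pl) : on A l -> on (inv O I A) l.
Proof.
move=> Al; apply: (proj1 (epsilon_spec (inhabits O) (fun Y => on Y (join O I) /\
    (A <> O -> mul O I A Y = I /\ mul O I Y A = I)) _)).
case: (classic (A = O)) => [->|AO]; first by exists O; split=> // /(_ eq_refl).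
have OA : O <> A by move=> E; apply: AO.
have [f [df [fO fI]]] := exists_homothety l O I A des OI Ol Il Al.
have [g [dg [gO gA]]] := exists_homothety l O A I des OA Ol Al Il.
(* [f] after [g] fixes [O] and [A], so it is the identity and [f (g I) = I]. *)
exists (g I); split; first exact: homothety_on.
move=> _; split; last by rewrite mulE.
rewrite -{1}fI (mulE O I _ f) //; first exact: homothety_on.
apply: (dilation_fix2 _ O A (dilation_comp f g df dg)) => //.
  by rewrite gO.
by rewrite gA.
Qed.

Lemma sub_on (A B : point pl) : on A l -> on B l -> on (sub O I A B) l.
Proof. by move=> Al Bl; apply: add_on => //; case: (oppP B). Qed.

(** * Values of the cross-ratio *)

Lemma cross_ratio_on (A B C D : point pl) :
  on A l -> on B l -> on C l -> on D l -> on (cross_ratio O I A B C D) l.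
Proof.
by move=> *; apply: mul_on; apply: mul_on; try apply: inv_on; apply: sub_on.
Qed.

(** The last factor vanishes, and a product with right factor [O] is [O] whatever point of the line
    stands on the left. *)
Lemma cross_ratio_zero (B C D : point pl) :
  on B l -> on C l -> on D l -> cross_ratio O I C B C D = O.
Proof.
move=> Bl Cl Dl; rewrite /cross_ratio.
have -> : sub O I C C = O by case: (oppP C Cl).
rewrite (mulr0 (inv O I (sub O I B C))); first by apply/inv_on/sub_on.
by apply: mulr0; apply: mul_on; [apply: inv_on|]; apply: sub_on.
Qed.

End LineArithmetic.

Theorem theorem1 (pl : affine_plane) (desargues_pl : desargues_axiom pl)
    (O I : point pl) (O_neq_I : O <> I)
    (B C D : point pl)
    (B_on : on B (join O I)) (C_on : on C (join O I)) (D_on : on D (join O I))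
    (B_neq_C : B <> C) (B_neq_D : B <> D) (C_neq_D : C <> D)
    (B_neq_O : B <> O) (C_neq_O : C <> O) (D_neq_O : D <> O) :
  let mu := fun X : point pl => cross_ratio O I X B C D in
  (forall X Y Z : point pl,
     on X (join O I) -> on Y (join O I) -> on Z (join O I) ->
     add O I (add O I (mu X) (mu Y)) (mu Z) =
     add O I (mu X) (add O I (mu Y) (mu Z))) /\
  (forall X Y : point pl,
     on X (join O I) -> on Y (join O I) ->
     add O I (mu X) (mu Y) = add O I (mu Y) (mu X)) /\
  (exists Z : point pl, on Z (join O I) /\
     forall X : point pl, on X (join O I) ->
     add O I (mu X) (mu Z) = mu X).
Proof.
move=> mu.
(* This covers [X = D]: the unspecified inverse of [O] is still a point of the line. *)
have mu_on X : on X (join O I) -> on (mu X) (join O I).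
  by move=> Xl; apply: cross_ratio_on.
split; first by move=> X Y Z Xl Yl Zl; apply: addA => //; apply: mu_on.
split; first by move=> X Y Xl Yl; apply: addC => //; apply: mu_on.
exists C; split=> // X Xl.
by rewrite {2}/mu cross_ratio_zero //; apply: addr0 => //; apply: mu_on.
Qed.
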